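(* Let $d\ge 2$ and let $\varphi=\sum_{i=0}^{d-1}\alpha_i e_i\otimes e_i\in\mathbb{C}^d\otimes\mathbb{C}^d$, where $\alpha_0\ge\cdots\ge\alpha_{d-1}>0$ and $\sum_{i=0}^{d-1}\alpha_i^2=1$. Let $\mathcal{M}\subseteq\mathcal{B}(\mathcal{H})$ be a von Neumann algebra. If $(R,\psi)$ exactly embezzles $\varphi$ in $(\mathcal{M},\mathcal{H})$, where $\psi$ is cyclic and separating for $\mathcal{M}$, then $\mathcal{M}$ is not semifinite.
   Context: $\{e_0,\dots,e_{d-1}\}$ is the canonical orthonormal basis of $\mathbb{C}^d$. Monopartite exact embezzlement: $(R,\psi)$ exactly embezzles $\varphi$ in $(\mathcal{M},\mathcal{H})$ if $R=\sum_{i,j=0}^{d-1}E_{ij}\otimes R_{ij}\in M_d\otimes\mathcal{M}$ is a contraction ($R_{ij}\in\mathcal{M}$, $E_{ij}$ the matrix units), $\psi\in\mathcal{H}$ is a unit vector, and, with $\omega=\langle(\cdot)\psi,\psi\rangle$, $\omega(R_{i0}^*XR_{j0})=\delta_{ij}\alpha_i^2\omega(X)$ for all $X\in\mathcal{M}$ and $i,j=0,\dots,d-1$. *)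

(* Defs.v *)
From HB Require Import structures.
From mathcomp Require Import all_boot all_order all_algebra complex.
From mathcomp Require Import all_classical all_reals all_analysis.

Set Implicit Arguments.
Unset Strict Implicit.
Unset Printing Implicit Defensive.

Import Order.TTheory GRing.Theory Num.Theory numFieldNormedType.Exports.

Local Open Scope classical_set_scope.
Local Open Scope ring_scope.
Local Open Scope complex_scope.

Section Operators.
Context {R : realType} {H : completeNormedModType R[i]}.

(* [ip] is linear in its first argument. Together with completeness of [H],
   this makes [H] a complex Hilbert space with inner product [ip]. *)
Definition norm_from_inner_product (ip : {dot H for Num.conj}) : Prop :=
  forall x : H, `|x| ^+ 2 = ip x x.

Definition bounded_operator (A : H -> H) : Prop :=
  linear A /\ exists c : R[i], forall x : H, `|A x| <= c * `|x|.

Variable ip : {dot H for Num.conj}.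

Definition is_adjoint (A B : H -> H) : Prop :=
  forall x y : H, ip (A x) y = ip x (B y).

(* Every bounded operator has a unique adjoint (Riesz), so the default value
   [0] only concerns maps that are not bounded operators. *)
Definition adj (A : H -> H) : H -> H := xget 0 [set B | is_adjoint A B].

Definition commutant (S : set (H -> H)) : set (H -> H) :=
  [set A | bounded_operator A /\ forall B, S B -> A \o B = B \o A].

(* A commutant is a unital subalgebra, so [M = M''] already makes [M] one. *)
Definition von_neumann_algebra (M : set (H -> H)) : Prop :=
  [/\ M `<=` bounded_operator,
      forall A, M A -> exists2 B, M B & is_adjoint A B &
      commutant (commutant M) = M].

Definition le_op (A B : H -> H) : Prop :=
  forall x : H, ip (A x) x <= ip (B x) x.

(* Over the complex numbers [0 <= z] includes that [z] is real; hence an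
   element of [pos_part M] is automatically self-adjoint. *)
Definition pos_part (M : set (H -> H)) : set (H -> H) :=
  [set A | M A /\ le_op 0 A].

Definition directed_op (D : set (H -> H)) : Prop :=
  D !=set0 /\
  forall A B, D A -> D B -> exists C, [/\ D C, le_op A C & le_op B C].

(* Least upper bound in [pos_part M]; for [D] consisting of positive operators
   this is the least upper bound in the self-adjoint part of [M]. *)
Definition is_op_lub (M D : set (H -> H)) (A : H -> H) : Prop :=
  [/\ pos_part M A,
      forall B, D B -> le_op B A &
      forall C, pos_part M C -> (forall B, D B -> le_op B C) -> le_op A C].

(* Only the values of [tau] on [pos_part M] are constrained. In [\bar R],
   [0 * +oo = 0]. *)
Definition tracial_weight (M : set (H -> H)) (tau : (H -> H) -> \bar R) : Prop :=
  [/\ forall A, pos_part M A -> (0 <= tau A)%E,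
      forall A B, pos_part M A -> pos_part M B ->
        tau (A + B) = (tau A + tau B)%E,
      forall (c : R) A, 0 <= c -> pos_part M A ->
        tau (c%:C *: A) = (c%:E * tau A)%E &
      forall A, M A -> tau (adj A \o A) = tau (A \o adj A)].

Definition faithful_weight (M : set (H -> H)) (tau : (H -> H) -> \bar R) : Prop :=
  forall A, pos_part M A -> tau A = 0%E -> A = 0.

Definition normal_weight (M : set (H -> H)) (tau : (H -> H) -> \bar R) : Prop :=
  forall D A, D `<=` pos_part M -> directed_op D -> is_op_lub M D A ->
    tau A = ereal_sup (tau @` D).

Definition semifinite_trace (M : set (H -> H)) (tau : (H -> H) -> \bar R) : Prop :=
  forall A, pos_part M A -> A <> 0 ->
    exists B, [/\ pos_part M B, B <> 0, le_op B A & (tau B < +oo)%E].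

Definition semifinite (M : set (H -> H)) : Prop :=
  exists tau : (H -> H) -> \bar R,
    [/\ tracial_weight M tau, faithful_weight M tau,
        normal_weight M tau & semifinite_trace M tau].

Definition cyclic_vector (M : set (H -> H)) (psi : H) : Prop :=
  dense [set A psi | A in M].

Definition separating_vector (M : set (H -> H)) (psi : H) : Prop :=
  forall A, M A -> A psi = 0 -> A = 0.

Definition vector_state (psi : H) (X : H -> H) : R[i] := ip (X psi) psi.

(* The operator sum_ij E_ij (x) T_ij acts on the Hilbert sum of [d] copies of
   [H] as the block matrix [T]. *)
Definition block_contraction (d : nat) (T : 'I_d -> 'I_d -> (H -> H)) : Prop :=
  forall x : 'I_d -> H,
    \sum_i `|\sum_j T i j (x j)| ^+ 2 <= \sum_j `|x j| ^+ 2.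

(* The vector [sum_i alpha_i e_i (x) e_i] enters only through its
   coefficients [alpha]. *)
Definition exactly_embezzles (M : set (H -> H)) (d : nat) (d_gt0 : (0 < d)%N)
    (alpha : 'I_d -> R) (T : 'I_d -> 'I_d -> (H -> H)) (psi : H) : Prop :=
  let o : 'I_d := Ordinal d_gt0 in
  let omega := vector_state psi in
  [/\ forall i j, M (T i j),
      block_contraction T,
      `|psi| = 1 &
      forall X, M X -> forall i j : 'I_d,
        omega (adj (T i o) \o X \o T j o)
          = (i == j)%:R * (alpha i ^+ 2)%:C * omega X].

End Operators.

(* Main.v *)
(* Suppose M has a faithful normal semifinite trace tau; write omega for the
   vector state of psi, V_i for T_i0, b_i for alpha_i^2 and a' for the adjoint
   of a.  Since psi is separating, sum_i V_i' V_i = 1, so V = (V_i) is an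
   isometry carrying omega to the state diag(b_i) (x) omega of M_d(M).  If h
   denotes the density of omega with respect to tau, then h and
   diag(b_i) (x) h are equidistributed, so S(c) = tau((h - c)_+) satisfies
   S(c) = sum_i b_i S(c / b_i).  As S is nonincreasing and b_i < 1, this forces
   S(c / b_i) = S(c), hence S is a positive constant along c / b_0^n, which
   contradicts S(c) -> 0 as c -> oo.

   The density is avoided by the variational formula
     S(c) = sup { omega(a' a) - c tau(a' a) : a in M a contraction },
   for which only the inequality S(c) <= sum_i b_i S(c / b_i) is needed (test
   with a V_i'), and by proving directly that omega(a_n' a_n) cannot stay away
   from 0 when tau(a_n' a_n) decays geometrically. *)
Require Import Defs.
From HB Require Import structures.
From mathcomp Require Import all_boot all_order all_algebra complex.
From mathcomp Require Import all_classical all_reals all_analysis.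
From mathcomp Require Import ring lra.

Set Implicit Arguments.
Unset Strict Implicit.
Unset Printing Implicit Defensive.

Import Order.TTheory GRing.Theory Num.Theory numFieldNormedType.Exports.

Local Open Scope classical_set_scope.
Local Open Scope ring_scope.
Local Open Scope complex_scope.

(** * The real inner product *)

Section RealForm.
Context {R : realType} {H : completeNormedModType R[i]}.
Context (ip : {dot H for Num.conj}) (ipN : norm_from_inner_product ip).

Definition rip (x y : H) : R := complex.Re (ip x y).
Definition sqn (x : H) : R := rip x x.

Lemma ipDl x y z : ip (x + y) z = ip x z + ip y z.
Proof. by rewrite linearDl. Qed.

Lemma ipDr x y z : ip z (x + y) = ip z x + ip z y.
Proof. by rewrite linearDr. Qed.

Lemma ipNl x z : ip (- x) z = - ip x z.
Proof. by rewrite linearNl. Qed.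

Lemma ipNr x z : ip z (- x) = - ip z x.
Proof. by rewrite linearNr. Qed.

Lemma ripDl x y z : rip (x + y) z = rip x z + rip y z.
Proof. by rewrite /rip ipDl raddfD. Qed.

Lemma ripNl x z : rip (- x) z = - rip x z.
Proof. by rewrite /rip linearNl raddfN. Qed.

Lemma ipC x y : ip y x = Num.conj (ip x y).
Proof. by rewrite (hermC ip y x) expr0 mul1r. Qed.

Lemma ripC x y : rip x y = rip y x.
Proof. by rewrite /rip (ipC x y); case: (ip x y). Qed.

Lemma ripDr x y z : rip z (x + y) = rip z x + rip z y.
Proof. by rewrite ripC ripDl !(ripC z). Qed.

Lemma ripNr x z : rip z (- x) = - rip z x.
Proof. by rewrite ripC ripNl ripC. Qed.

Lemma ipZl a x y : ip (a *: x) y = a * ip x y.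
Proof. by rewrite linearZl_LR. Qed.

Lemma ipZr a x y : ip x (a *: y) = Num.conj a * ip x y.
Proof. by rewrite linearZr_LR. Qed.

Lemma ripZl (a : R) x y : rip (a%:C *: x) y = a * rip x y.
Proof.
by rewrite /rip ipZl; case: (ip x y) => u v /=; rewrite mul0r subr0.
Qed.

Lemma ripZr (a : R) x y : rip x (a%:C *: y) = a * rip x y.
Proof. by rewrite ripC ripZl ripC. Qed.

Definition ripE := (ripDl, ripDr, ripNl, ripNr, ripZl, ripZr).

Lemma ipxx x : ip x x = (sqn x)%:C.
Proof.
have : 0 <= ip x x by rewrite -ipN exprn_ge0.
by rewrite /sqn /rip; case: (ip x x) => a b; rewrite lecE /= => /andP[/eqP-> _].
Qed.

Lemma sqn_ge0 x : 0 <= sqn x.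
Proof. by have := exprn_ge0 2 (normr_ge0 x); rewrite ipN ipxx ler0c. Qed.

Lemma ip_normE x : `|x| = (Num.sqrt (sqn x))%:C.
Proof.
apply/eqP; rewrite -(eqrXn2 (n:=2)) // ?ipN ?ler0c ?sqrtr_ge0 //.
by rewrite -rmorphXn /= sqr_sqrtr ?sqn_ge0 // ipxx.
Qed.

Lemma sqn_eq0 x : sqn x = 0 -> x = 0.
Proof. by move=> h; apply: normr0_eq0; rewrite ip_normE h sqrtr0. Qed.

Lemma sqnN x : sqn (- x) = sqn x.
Proof. by rewrite /sqn ripNl ripNr opprK. Qed.

Lemma sqnB x y : sqn (x - y) = sqn (y - x).
Proof. by rewrite -sqnN opprB. Qed.

Lemma Re_mul_real (z : R[i]) (r : R) : complex.Re (z * r%:C) = complex.Re z * r.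
Proof. by case: z => u v /=; rewrite mulr0 subr0. Qed.

Lemma sqnZ a x : sqn (a *: x) = complex.Re (`|a| ^+ 2) * sqn x.
Proof.
have /(congr1 (@complex.Re R)) : ip (a *: x) (a *: x) = `|a| ^+ 2 * (sqn x)%:C.
  by rewrite ipZl ipZr ipxx mulrA normCK.
by rewrite ipxx Re_mul_real /= => ->.
Qed.

Lemma sqnD_le x y : sqn (x + y) <= 2 * sqn x + 2 * sqn y.
Proof.
have := sqn_ge0 (x - y); rewrite /sqn !ripE (ripC y x); lra.
Qed.

(** Weighted Young inequality, from $\|ex-y\|^2\ge 0$. It plays the part of Cauchy-Schwarz and keeps
    the estimates in squared norms. *)
Lemma rip_le (e : R) x y : 0 < e -> 2 * rip x y <= e * sqn x + e^-1 * sqn y.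
Proof.
move=> e0; rewrite -subr_ge0.
suff -> : e * sqn x + e^-1 * sqn y - 2 * rip x y
    = e^-1 * sqn (e%:C *: x - y) by rewrite mulr_ge0 ?sqn_ge0 ?invr_ge0 ?ltW.
by rewrite /sqn !ripE (ripC y x); field; rewrite gt_eqF.
Qed.

Lemma cvg_sqnP (u : nat -> H) (l : H) :
  u @ \oo --> l <->
  (forall e : R, 0 < e -> exists N, forall n, (N <= n)%N -> sqn (l - u n) <= e).
Proof.
split=> [/cvgrPdist_le ul e e0|ul].
  have /ul[N _ Nu] : 0 < (Num.sqrt e)%:C by rewrite ltcR sqrtr_gt0.
  exists N => n Nn; have := Nu n Nn.
  by rewrite /= ip_normE lecR ler_sqrt // ltW.
apply/cvgrPdist_le => -[a b]; rewrite ltcE /= => /andP[/eqP -> a0].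
have [N Nu] := ul (a ^+ 2) (exprn_gt0 _ a0).
exists N => // n /= Nn; rewrite ip_normE lecR.
by rewrite -(ger0_norm (ltW a0)) -sqrtr_sqr ler_sqrt ?sqr_ge0 ?Nu.
Qed.

Lemma cauchy_sqn_cvg (u : nat -> H) :
  (forall e : R, 0 < e -> exists N, forall n m, (N <= n)%N -> (n <= m)%N ->
     sqn (u m - u n) <= e) -> exists l : H, u @ \oo --> l.
Proof.
move=> cu; suff : cvgn u by move=> cv; exists (limn u).
apply/cauchy_cvgP/cauchy_ballP => -[a b].
rewrite ltcE /= => /andP[/eqP -> a0].
(* Balls are open while the Cauchy bound is weak; halving the radius restores strictness. *)
have a2 : 0 < (a / 2) ^+ 2 by rewrite exprn_gt0 ?divr_gt0.
have [N Nu] := cu _ a2.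
pose U := [set u n | n in [set n | (N <= n)%N]].
exists (U, U); first by split; exists N => // n Nn; exists n.
move=> [_ _] [/= [n Nn <-] [m Nm <-]]; rewrite -ball_normE /= ip_normE ltcR.
apply: (@le_lt_trans _ _ (a / 2)); last by lra.
have a20 : 0 <= a / 2 by lra.
rewrite -(ger0_norm a20) -sqrtr_sqr ler_sqrt ?sqr_ge0 //.
by case/orP: (leq_total n m) => nm; [rewrite sqnB|]; exact: Nu.
Qed.

Lemma cvg_rip (u : nat -> H) (l y : H) :
  u @ \oo --> l -> (fun n => rip (u n) y) @ \oo --> rip l y.
Proof.
move=> /cvg_sqnP ul; apply/cvgrPdist_le => e e0.
(* This weight makes both Young terms at most [e]; the [+ 1] keeps it positive when [y] is 0. *)
pose k := (sqn y + 1) / e.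
have k0 : 0 < k by rewrite divr_gt0 // ltr_wpDl ?sqn_ge0.
have [N Nu] := ul (e / k) (divr_gt0 e0 k0).
exists N => // n /= /Nu h2.
have h3 := rip_le (l - u n) y k0; have h3' := rip_le (l - u n) (- y) k0.
have h4 : k * sqn (l - u n) <= e by rewrite -ler_pdivlMl // mulrC.
have h5 : k^-1 * sqn y <= e.
  rewrite /k invf_div mulrAC ler_pdivrMr ?ltr_wpDl ?sqn_ge0 //.
  by rewrite ler_pM2l // lerDl.
by move: h3 h3'; rewrite sqnN !ripE ler_norml => h3 h3'; apply/andP; split; lra.
Qed.

Lemma cvg_rip_le (u : nat -> H) (l y : H) (b : R) :
  u @ \oo --> l -> (\forall n \near \oo, rip (u n) y <= b) -> rip l y <= b.
Proof.
move=> /(cvg_rip (y := y)) ul ub; rewrite -(cvg_lim _ ul) //.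
by apply: limr_le => //; apply: cvgP ul.
Qed.

Lemma cvg_rip_ge (u : nat -> H) (l y : H) (b : R) :
  u @ \oo --> l -> (\forall n \near \oo, b <= rip (u n) y) -> b <= rip l y.
Proof.
move=> /(cvg_rip (y := y)) ul ub; rewrite -(cvg_lim _ ul) //.
by apply: limr_ge => //; apply: cvgP ul.
Qed.

End RealForm.

(** * Operators and quadratic forms *)

Section Operators.
Context {R : realType} {H : completeNormedModType R[i]}.
Context (ip : {dot H for Num.conj}) (ipN : norm_from_inner_product ip).

Local Notation rip := (rip ip).
Local Notation sqn := (sqn ip).
Local Notation selfadj A := (is_adjoint ip A A).

Lemma lin0 (A : H -> H) : linear A -> A 0 = 0.
Proof.
by move=> lA; have := lA 1 0 0; rewrite !scale1r addr0 -{1}[A 0]addr0 => /addrI.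
Qed.

Lemma linD (A : H -> H) : linear A -> {morph A : x y / x + y}.
Proof. by move=> lA x y; have := lA 1 x y; rewrite !scale1r. Qed.

Lemma linZ (A : H -> H) : linear A -> forall a, {morph A : x / a *: x}.
Proof. by move=> lA a x; have := lA a x 0; rewrite !addr0 lin0 // addr0. Qed.

Lemma linN (A : H -> H) : linear A -> {morph A : x / - x}.
Proof. by move=> lA x; rewrite -scaleN1r linZ // scaleN1r. Qed.

Lemma linB (A : H -> H) : linear A -> {morph A : x y / x - y}.
Proof. by move=> lA x y; rewrite linD // linN. Qed.

Lemma lin_sum (A : H -> H) : linear A ->
  forall (I : Type) (r : seq I) (P : pred I) (F : I -> H),
  A (\sum_(i <- r | P i) F i) = \sum_(i <- r | P i) A (F i).
Proof.
move=> lA I r P F.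
by elim/big_rec2 : _ => [|i x y _ <-]; [exact: lin0 | rewrite linD].
Qed.

Lemma boundedP (A : H -> H) : bounded_operator A <->
  linear A /\ exists2 c : R, 0 <= c & forall x, sqn (A x) <= c * sqn x.
Proof.
split=> [[lA [c Ac]]|[lA [c c0 Ac]]]; split=> //.
- exists ((complex.Re c) ^+ 2) => [|x]; first exact: sqr_ge0.
  have := Ac x; rewrite !(ip_normE ipN) lecE => /andP[_].
  rewrite Re_mul_real /= => h.
  rewrite -(sqr_sqrtr (sqn_ge0 ipN (A x))) -(sqr_sqrtr (sqn_ge0 ipN x)) -exprMn.
  by rewrite ler_pXn2r // ?nnegrE ?sqrtr_ge0 // (le_trans _ h) ?sqrtr_ge0.
- exists (Num.sqrt c)%:C => x; rewrite !(ip_normE ipN) -rmorphM lecR.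
  by rewrite -sqrtrM // ler_sqrt ?Ac ?mulr_ge0 ?sqn_ge0.
Qed.

Lemma adjoint_rip A B : is_adjoint ip A B ->
  forall x y, rip (A x) y = rip x (B y).
Proof. by move=> AB x y; rewrite /rip AB. Qed.

Lemma adjoint_sym A B : is_adjoint ip A B -> is_adjoint ip B A.
Proof. by move=> AB x y; rewrite ipC -AB -ipC. Qed.

Lemma ip_inj (u v : H) : (forall x, ip x u = ip x v) -> u = v.
Proof.
move=> uv; apply/eqP; rewrite -subr_eq0; apply/eqP/(sqn_eq0 ipN).
by rewrite /sqn ripDr ripNr /rip uv subrr.
Qed.

Lemma adjE A B : is_adjoint ip A B -> adj ip A = B.
Proof.
move=> AB; apply: xget_unique => // C AC.
by apply/funext => y; apply: ip_inj => x; rewrite -AC -AB.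
Qed.

Lemma selfadj_Im A x : selfadj A -> complex.Im (ip (A x) x) = 0.
Proof.
move=> /(_ x x); rewrite [RHS]ipC; case: (ip (A x) x) => a b [] /eqP.
by rewrite -addr_eq0 -mulr2n mulrn_eq0 => /eqP.
Qed.

Lemma le_opP A B : selfadj A -> selfadj B ->
  le_op ip A B <-> forall x, rip (A x) x <= rip (B x) x.
Proof.
move=> sA sB; rewrite /le_op /rip; split => h x; have := h x.
  by rewrite lecE => /andP[].
by rewrite lecE !selfadj_Im // eqxx.
Qed.

(** Polarization: the form at $u+av$ leaves only the cross terms, and $a=1$, $a=i$ separate them. *)
Lemma form_inj (A : H -> H) : linear A -> (forall x, ip (A x) x = 0) -> A = 0.
Proof.
move=> lA A0; apply/funext => x; apply: ip_inj => y; rewrite linear0r.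
have h a u v : Num.conj a * ip (A u) v + a * ip (A v) u = 0.
  have := A0 (u + a *: v); rewrite (linD lA) (linZ lA) !ipDl !ipDr.
  by rewrite !ipZl !ipZr !A0 !mulr0 addr0 add0r.
have /eqP := h 1 x y; rewrite conjC1 !mul1r addr_eq0 => /eqP xy.
have := h 'i%R x y; rewrite conjCi xy mulrNN -mulr2n => /eqP.
rewrite mulrn_eq0 mulf_eq0 (negPf (neq0Ci _)) /= => /eqP yx.
by rewrite ipC xy yx oppr0 conjC0.
Qed.

(** By linearity, the real identity at $ix$ yields the imaginary parts at $x$. *)
Lemma rip_selfadj (A : H -> H) : linear A ->
  (forall x y, rip (A x) y = rip x (A y)) -> selfadj A.
Proof.
move=> lA rA x y; have := rA ('i%C *: x) y; have := rA x y.
rewrite (linZ lA) /rip !ipZl; case: (ip _ _) => a b;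
  case: (ip _ _) => c e /= -> .
by rewrite !mul0r !sub0r !mul1r => /oppr_inj ->.
Qed.

(* With [t = 1/c], expand [0 <= <P w, w>] at [w = x - t P x]. *)
Lemma sqn_bound (P : H -> H) (c : R) : linear P -> selfadj P -> 0 < c ->
  (forall x, 0 <= rip (P x) x <= c * sqn x) ->
  forall x, sqn (P x) <= c * rip (P x) x.
Proof.
move=> lP /adjoint_rip sP c0 hP x.
have /andP[h _] := hP (x - c^-1%:C *: P x); have /andP[_ h'] := hP (P x).
move: h; rewrite (linB lP) (linZ lP) !ripE (sP (P x) x).
rewrite -/(sqn (P x)) => h.
have : 0 <= c * (rip (P x) x - 2 * (c^-1 * sqn (P x))
              + c^-1 * (c^-1 * rip (P (P x)) (P x))).
  by apply: mulr_ge0 (ltW c0) _; lra.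
have -> : c * (rip (P x) x - 2 * (c^-1 * sqn (P x))
              + c^-1 * (c^-1 * rip (P (P x)) (P x)))
   = c * rip (P x) x - 2 * sqn (P x) + c^-1 * rip (P (P x)) (P x).
  by field; rewrite gt_eqF.
have : c^-1 * rip (P (P x)) (P x) <= sqn (P x) by rewrite ler_pdivrMl.
lra.
Qed.

End Operators.

(** * Von Neumann algebras *)

Section VonNeumannAlgebra.
Context {R : realType} {H : completeNormedModType R[i]}.
Context (ip : {dot H for Num.conj}) (ipN : norm_from_inner_product ip).
Context (M : set (H -> H)) (M_vN : von_neumann_algebra ip M).

Local Notation rip := (rip ip).
Local Notation sqn := (sqn ip).
Local Notation selfadj A := (is_adjoint ip A A).
Local Notation Mpos := (pos_part ip M).

Lemma vN_lin A : M A -> linear A.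
Proof. by case: M_vN => h _ _ /h[]. Qed.

Lemma vN_bound A : M A ->
  exists2 c : R, 0 <= c & forall x, sqn (A x) <= c * sqn x.
Proof. by case: M_vN => h _ _ /h /(boundedP ipN)[]. Qed.

(** Pointwise membership test from $M=M''$; closure of [M] under algebraic operations and under
    strong limits is proved through it. *)
Lemma vNP A : linear A ->
  (exists2 c : R, 0 <= c & forall x, sqn (A x) <= c * sqn x) ->
  (forall B, linear B ->
     (exists2 c : R, 0 <= c & forall x, sqn (B x) <= c * sqn x) ->
     (forall C x, M C -> B (C x) = C (B x)) -> forall x, A (B x) = B (A x)) ->
  M A.
Proof.
case: M_vN => _ _ Mcc lA bA cA.
suff : commutant (commutant M) A by rewrite Mcc.
split; first exact/(boundedP ipN).
move=> B [/(boundedP ipN)[lB bB] BM]; apply/funext => x; apply: cA => // C y MC.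
by have /(congr1 (fun f => f y)) := BM _ MC.
Qed.

Lemma vN_id : M id.
Proof. by apply: vNP => //; exists 1 => // x; rewrite mul1r. Qed.

Lemma vNZ (a : R[i]) A : M A -> M (a *: A).
Proof.
move=> MA; have lA := vN_lin MA; apply: vNP.
- by move=> b u v; rewrite !fctE lA scalerDr !scalerA mulrC.
- have [c c0 Ac] := vN_bound MA; exists (complex.Re (`|a| ^+ 2) * c) => [|x].
    by rewrite mulr_ge0 //; have := exprn_ge0 2 (normr_ge0 a);
      rewrite lecE => /andP[].
  rewrite fctE (sqnZ ipN) -mulrA ler_wpM2l //.
  by have := exprn_ge0 2 (normr_ge0 a); rewrite lecE => /andP[].
- by move=> B lB _ BM x; rewrite !fctE (linZ lB) (BM A).
Qed.

Lemma vN0 : M 0.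
Proof. by have := vNZ 0 vN_id; rewrite scale0r. Qed.

Lemma vND A B : M A -> M B -> M (A + B).
Proof.
move=> MA MB; have lA := vN_lin MA; have lB := vN_lin MB; apply: vNP.
- by move=> b u v; rewrite !fctE lA lB scalerDr addrACA.
- have [c c0 Ac] := vN_bound MA; have [e e0 Be] := vN_bound MB.
  exists (2 * c + 2 * e) => [|x]; first by lra.
  by rewrite (le_trans (sqnD_le ipN _ _)) //; have := Ac x; have := Be x; lra.
- by move=> C lC _ CM x; rewrite !fctE (linD lC) (CM A) ?(CM B).
Qed.

Lemma vNN A : M A -> M (- A).
Proof. by rewrite -scaleN1r; apply: vNZ. Qed.

Lemma vNB A B : M A -> M B -> M (A - B).
Proof. by move=> MA /vNN; apply: vND. Qed.

Lemma vN_comp A B : M A -> M B -> M (A \o B).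
Proof.
move=> MA MB; have lA := vN_lin MA; have lB := vN_lin MB; apply: vNP.
- by move=> b u v; rewrite /= lB lA.
- have [c c0 Ac] := vN_bound MA; have [e e0 Be] := vN_bound MB.
  exists (c * e) => [|x]; first by rewrite mulr_ge0.
  by rewrite (le_trans (Ac _)) // -mulrA ler_wpM2l.
- by move=> C lC _ CM x; rewrite /= (CM A) ?(CM B).
Qed.

Lemma vN_sum (I : finType) (F : I -> H -> H) :
  (forall i, M (F i)) -> M (\sum_i F i).
Proof. by move=> MF; elim/big_ind: _ => //; [exact: vN0 | exact: vND]. Qed.

Lemma vN_adjoint A : M A -> is_adjoint ip A (adj ip A).
Proof. by case: M_vN => _ h _ /h[B _ AB]; rewrite (adjE ipN AB). Qed.

Lemma vN_adj A : M A -> M (adj ip A).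
Proof. by case: M_vN => _ h _ /h[B MB AB]; rewrite (adjE ipN AB). Qed.

Lemma adj_comp A B : M A -> M B -> adj ip (A \o B) = adj ip B \o adj ip A.
Proof.
by move=> MA MB; apply: (adjE ipN) => x y; rewrite /= !vN_adjoint.
Qed.

Lemma vN_adjK A : M A -> adj ip (adj ip A) = A.
Proof. by move=> MA; apply: (adjE ipN); apply/adjoint_sym/vN_adjoint. Qed.

Lemma selfadjD A B : selfadj A -> selfadj B -> selfadj (A + B).
Proof. by move=> sA sB x y; rewrite !fctE ipDl ipDr sA sB. Qed.

Lemma selfadjN A : selfadj A -> selfadj (- A).
Proof. by move=> sA x y; rewrite !fctE ipNl ipNr sA. Qed.

Lemma selfadjB A B : selfadj A -> selfadj B -> selfadj (A - B).
Proof. by move=> sA sB; apply/selfadjD/selfadjN. Qed.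

Lemma vN_posP A : Mpos A <->
  [/\ M A, selfadj A & forall x, 0 <= rip (A x) x].
Proof.
have ip0 x : ip ((0 : H -> H) x) x = 0 by rewrite linear0l.
split=> [[MA pA]|[MA sA pA]]; last first.
  split=> // x; rewrite ip0 lecE selfadj_Im // eqxx; exact: pA.
have {}pA x : 0 <= ip (A x) x by have := pA x; rewrite ip0.
split=> // [|x]; last by have := pA x; rewrite lecE => /andP[].
(* The form of [A] is real, so that of [A - adj ip A] vanishes and polarization applies. *)
suff /eqP : A - adj ip A = 0.
  by rewrite subr_eq0 => /eqP AE; rewrite {2}AE; apply: vN_adjoint.
apply: (form_inj ipN) => [|x].
  by apply: vN_lin; apply: vNB => //; apply: vN_adj.
rewrite fctE ipDl ipNl (adjoint_sym (vN_adjoint MA)).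
by rewrite (ipC ip (A x) x) geC0_conj // subrr.
Qed.

Lemma vN_cvg (A : nat -> H -> H) (L : H -> H) (c : R) : 0 <= c ->
  (forall n, M (A n)) -> (forall n x, sqn (A n x) <= c * sqn x) ->
  (forall x, (A ^~ x) @ \oo --> L x) -> M L.
Proof.
move=> c0 MA Ac AL.
have uniq (u : nat -> H) (a b : H) : u @ \oo --> a -> u @ \oo --> b -> a = b.
  by move=> ua ub; apply: cvg_unique ua ub => //; exact: norm_hausdorff.
apply: vNP.
- move=> a x y; apply: uniq (AL (a *: x + y)) _.
  have -> : A ^~ (a *: x + y) = (a \*: (A ^~ x)) + A ^~ y.
    by apply/funext => n; rewrite fctE (vN_lin (MA n)).
  by apply: cvgD => //; apply: cvgZl_tmp.
- exists c => // x.
  (* Young's inequality for [A n x] and [L x], in the limit; half of [sqn (L x)] is then absorbed on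
     the left. *)
  have : rip (L x) (L x) <= (c * sqn x + sqn (L x)) / 2.
    apply: (cvg_rip_le ipN) (AL x) _; apply: nearW => n.
    have := rip_le ipN (A n x) (L x) ltr01; have := Ac n x.
    by rewrite invr1 !mul1r; lra.
  rewrite -/(sqn (L x)); lra.
- move=> B lB [e e0 Be] BM x; apply: uniq (AL (B x)) _.
  have -> : A ^~ (B x) = B \o A ^~ x by apply/funext => n /=; rewrite BM.
  apply/(cvg_sqnP ipN) => d d0.
  have [|N NA] := (cvg_sqnP ipN _ _).1 (AL x) (d / (e + 1)).
    by rewrite divr_gt0 // ltr_wpDl.
  exists N => n /NA h; rewrite -(linB lB) (le_trans (Be _)) //.
  have : (e + 1) * sqn (L x - A n x) <= d
    by rewrite mulrC -ler_pdivlMr // ltr_wpDl.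
  by have := sqn_ge0 ipN (L x - A n x); lra.
Qed.

End VonNeumannAlgebra.

(** * Monotone limits and resolvents *)

Section Resolvent.
Context {R : realType} {H : completeNormedModType R[i]}.
Context (ip : {dot H for Num.conj}) (ipN : norm_from_inner_product ip).
Context (M : set (H -> H)) (M_vN : von_neumann_algebra ip M).

Local Notation rip := (rip ip).
Local Notation sqn := (sqn ip).
Local Notation selfadj A := (is_adjoint ip A A).
Local Notation Mpos := (pos_part ip M).

(** Vigier's theorem. For $n\le m$ the difference $D=A_m-A_n$ satisfies $0\le D\le 1$, so
    $\|Dx\|^2\le\langle Dx,x\rangle$, and convergence of the scalar forms makes $A_nx$ Cauchy. *)
Lemma monotone_operator_cvg (A : nat -> H -> H) :
  (forall n, Mpos (A n)) ->
  (forall n m x, (n <= m)%N -> rip (A n x) x <= rip (A m x) x) ->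
  (forall n x, rip (A n x) x <= sqn x) ->
  exists2 L, Mpos L & forall x, (A ^~ x) @ \oo --> L x.
Proof.
move=> pA Amono A1.
have MA n : M (A n) by have /(vN_posP ipN M_vN)[] := pA n.
have sA n : selfadj (A n) by have /(vN_posP ipN M_vN)[] := pA n.
have A0 n x : 0 <= rip (A n x) x by have /(vN_posP ipN M_vN)[_ _] := pA n.
have cvgA x : exists l : H, (A ^~ x) @ \oo --> l.
  apply: (cauchy_sqn_cvg ipN) => e e0.
  pose a n := rip (A n x) x.
  have a_mono : {homo a : n m / (n <= m)%N >-> n <= m}.
    by move=> n m; apply: Amono.
  have a_cvg : cvgn a.
    apply: nondecreasing_is_cvgn => //; exists (sqn x) => _ [n _ <-]; exact: A1.
  have /cvgrPdist_le /(_ e e0)[N _ NA] := a_cvg; exists N => n m Nn nm.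
  pose D := A m - A n.
  have D01 y : 0 <= rip (D y) y <= 1 * sqn y.
    have := Amono n m y nm; have := A1 m y; have := A0 n y.
    by rewrite /D !fctE ripDl ripNl mul1r => *; apply/andP; split; lra.
  have lD : linear D by apply: (vN_lin M_vN); apply: (vNB ipN M_vN).
  have := sqn_bound lD (selfadjB (sA m) (sA n)) ltr01 D01 x.
  rewrite mul1r => /le_trans; apply;
    rewrite /D !fctE ripDl ripNl -/(a m) -/(a n).
  have := NA n Nn; have := nondecreasing_cvgn_le a_mono a_cvg m.
  by rewrite /= ler_norml => h /andP[_]; lra.
exists (fun x => sval (cid (cvgA x))) => [|x]; last by case: cid.
set L := fun x => _.
have AL x : (A ^~ x) @ \oo --> L x by rewrite /L; case: cid.
have ML : M L.
  apply: (vN_cvg ipN M_vN (c := 1)) AL => // n x.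
  have h y : 0 <= rip (A n y) y <= 1 * sqn y by rewrite A0 mul1r A1.
  have := sqn_bound (vN_lin M_vN (MA n)) (sA n) ltr01 h x.
  by rewrite !mul1r => /le_trans; apply.
apply/(vN_posP ipN M_vN); split=> // [|x].
  apply: rip_selfadj (vN_lin M_vN ML) _ => x y; rewrite [RHS]ripC.
  apply: cvg_unique (cvg_rip ipN (AL x)) _ => //.
  have -> : (fun n => rip (A n x) y) = (fun n => rip (A n y) x).
    by apply/funext => n; rewrite (adjoint_rip (sA n)) ripC.
  exact: cvg_rip.
by apply: (cvg_rip_ge ipN) (AL x) _; apply: nearW => n.
Qed.

(** For positive [s] this is $r=(1+s)^{-1}$, encoded as a right inverse lying in [M]. *)
Definition is_resolvent (s r : H -> H) := M r /\ forall x, r x + s (r x) = x.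

(** Neumann series: for $s\le C$ and $t=1/(1+C)$, the operator $P=1-t(1+s)$ satisfies $0\le P\le
    q=1-t<1$, so $\sum_k P^k$ converges to the inverse of $t(1+s)$. *)
Lemma resolvent_exists s : Mpos s -> exists r, is_resolvent s r.
Proof.
move=> /(vN_posP ipN M_vN)[Ms ss s0].
have [c c0 sc] := vN_bound ipN M_vN Ms.
pose C := (c + 1) / 2; have C0 : 0 < C by rewrite /C; lra.
have sC x : rip (s x) x <= C * sqn x.
  have := rip_le ipN (s x) x ltr01; have := sc x; rewrite invr1 !mul1r /C; lra.
pose t := (1 + C)^-1; have t0 : 0 < t by rewrite invr_gt0; lra.
have tC : t * (1 + C) = 1 by rewrite mulVf // gt_eqF //; lra.
have tC0 : 0 < t * C by rewrite mulr_gt0.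
pose q := t * C; have qE : 1 - t = q by rewrite /q; lra.
pose P := id - t%:C *: (id + s).
have MP : M P.
  by apply: (vNB ipN M_vN (vN_id ipN M_vN)); apply: (vNZ ipN M_vN);
  exact: (vND ipN M_vN (vN_id ipN M_vN) Ms).
have PE x : P x = x - t%:C *: (x + s x) by [].
clearbody P; have lP := vN_lin M_vN MP.
have sP : selfadj P.
  by apply: rip_selfadj => // x y; rewrite !PE !ripE (adjoint_rip ss).
have P0q x : 0 <= rip (P x) x <= q * sqn x.
  rewrite PE !ripE -/(sqn x).
  have := sqn_ge0 ipN x; have := mulr_ge0 (ltW t0) (s0 x) => h1 h2.
  have := ler_wpM2l (ltW t0) (sC x) => h3.
  have : t * (C * sqn x) = sqn x - t * sqn x by rewrite mulrA -/q -qE; ring.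
  by rewrite -qE => h4; apply/andP; split; lra.
have Pq x : sqn (P x) <= q * (q * sqn x).
  rewrite (le_trans (sqn_bound lP sP tC0 P0q x)) // ler_wpM2l ?(ltW tC0) //.
  by have /andP[] := P0q x.
have q1 : q < 1 by lra.
have Pq1 x : sqn (P x) <= q * sqn x.
  rewrite (le_trans (Pq x)) // ler_wpM2l ?(ltW tC0) //.
  by rewrite ler_piMl ?sqn_ge0 ?ltW.
(* Partial sums of the Neumann series, in the Horner form $N_{n+1}=1+PN_n$. *)
pose N := fix N n := if n is k.+1 then id + (P \o N k) else (0 : H -> H).
have NS n x : N n.+1 x = x + P (N n x) by [].
have N0 x : N 0 x = 0 by [].
have MN n : M (N n).
  elim: n => [|n MNn]; first exact: (vN0 ipN M_vN).
  by apply: (vND ipN M_vN (vN_id ipN M_vN)); apply: (vN_comp ipN M_vN).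
clearbody N.
(* The square of the geometric sum $1/(1-q)$, hence a uniform bound for the squared norms of the
   partial sums. *)
pose B := (1 - q)^-1 * (1 - q)^-1.
have q10 : 0 < 1 - q by lra.
have B0 : 0 <= B by rewrite mulr_ge0 // invr_ge0 ltW.
have NB n x : sqn (N n x) <= B * sqn x.
  elim: n => [|n IHn].
    by rewrite N0 /sqn /rip linear0l mulr_ge0 ?sqn_ge0.
  rewrite NS.
  (* With this Young weight the induction closes exactly: $qB+1/(1-q)=B$. *)
  have e0 : 0 < q / (1 - q) by rewrite divr_gt0.
  have := rip_le ipN x (P (N n x)) e0.
  have := Pq (N n x); rewrite -ler_pdivrMl // => h1 h2.
  have -> : sqn (x + P (N n x))
    = sqn x + 2 * rip x (P (N n x)) + sqn (P (N n x)).
    by rewrite /sqn !ripE (ripC ip (P _) x); ring.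
  have h3 : sqn x + q / (1 - q) * sqn x = (1 - q)^-1 * sqn x.
    by field; rewrite gt_eqF.
  have h4 : (q / (1 - q))^-1 * sqn (P (N n x)) + sqn (P (N n x))
     = q^-1 * sqn (P (N n x)).
    by field; rewrite !gt_eqF.
  have h5 : q * (B * sqn x) + (1 - q)^-1 * sqn x = B * sqn x.
    by rewrite /B; field; rewrite gt_eqF.
  have := ler_wpM2l (ltW tC0) IHn; rewrite -/q.
  lra.
have ND n k x : sqn (N (n + k)%N x - N n x) <= q ^+ n * (B * sqn x).
  elim: n => [|n IHn]; first by rewrite add0n N0 subr0 expr0 mul1r.
  rewrite addSn !NS opprD addrACA subrr add0r -(linB lP).
  by rewrite (le_trans (Pq1 _)) // exprS -mulrA ler_wpM2l // ltW.
have cvgN x : exists l : H, (N ^~ x) @ \oo --> l.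
  apply: (cauchy_sqn_cvg ipN) => e e0.
  have : (fun n => q ^+ n) @ \oo --> (0 : R) by apply: cvg_expr;
    rewrite gtr0_norm.
  have e1 : 0 < e / (B * sqn x + 1)
    by rewrite divr_gt0 // ltr_wpDl // mulr_ge0 ?sqn_ge0.
  move=> /cvgrPdist_le /(_ _ e1)[K _ NK]; exists K => n m Kn nm.
  have := ND n (m - n)%N x; rewrite subnKC // => /le_trans; apply.
  have := NK n Kn; rewrite /= sub0r normrN ger0_norm ?exprn_ge0 ?(ltW tC0) //.
  rewrite ler_pdivlMr; last by rewrite ltr_wpDl // mulr_ge0 ?sqn_ge0.
  by move=> h; rewrite (le_trans _ h) // ler_wpM2l ?exprn_ge0 ?(ltW tC0) //
    lerDl.
pose L x := sval (cid (cvgN x)).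
have NL x : (N ^~ x) @ \oo --> L x by rewrite /L; case: cid.
have ML : M L by apply: (vN_cvg ipN M_vN B0 MN NB NL).
(* Passing to the limit in the recursion; unfolding [P] turns the fixed point into $t(1+s)Lx=x$. *)
have LP x : L x = x + P (L x).
  apply: cvg_unique (NL x) _; first exact: norm_hausdorff.
  apply/(cvg_sqnP ipN) => e e0.
  have [K NK] := (cvg_sqnP ipN _ _).1 (NL x) e e0.
  exists K.+1 => -[//|n] /NK h; rewrite NS opprD addrACA subrr add0r -(linB lP).
  rewrite (le_trans (Pq1 _)) // (le_trans _ h) // ler_piMl ?sqn_ge0 ?ltW //.
exists (t%:C *: L); split=> [|x]; first exact: (vNZ ipN M_vN).
rewrite !fctE (linZ (vN_lin M_vN Ms)) -scalerDr.
have := LP x; rewrite PE => /eqP; rewrite addrCA -subr_eq0 opprD addrA subrr.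
by rewrite add0r oppr_eq0 subr_eq0 => /eqP.
Qed.

(** * Order estimates for the resolvent *)

Section ResolventTheory.
Context (s r : H -> H) (s_pos : Mpos s) (rs : is_resolvent s r).

Let Ms : M s. Proof. by case: s_pos. Qed.
Let ss : selfadj s. Proof. by have /(vN_posP ipN M_vN)[] := s_pos. Qed.
Let s0 x : 0 <= rip (s x) x. Proof.
  by have /(vN_posP ipN M_vN)[_ _] := s_pos. Qed.
Let Mr : M r. Proof. by case: rs. Qed.
Let rK x : r x + s (r x) = x. Proof. by case: rs. Qed.

Lemma resolvent_pos : Mpos r.
Proof.
apply/(vN_posP ipN M_vN); split=> // [|x].
  apply: rip_selfadj (vN_lin M_vN Mr) _ => x y.
  by rewrite -{2}(rK x) -{1}(rK y) !ripE (adjoint_rip ss).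
by rewrite -{2}(rK x) ripDr addr_ge0 ?sqn_ge0 // ripC s0.
Qed.

(* Equality holds at [v = r x]; this variational formula makes the resolvent
   order-reversing. *)
Lemma resolvent_ge x v : 2 * rip x v - sqn v - rip (s v) v <= rip (r x) x.
Proof.
move: (rK x); set u := r x => xE.
have := s0 (u - v); have := sqn_ge0 ipN (u - v).
rewrite -{1 2}xE (linB (vN_lin M_vN Ms)) /sqn !ripE.
rewrite (ripC ip v u) (ripC ip u (s u)) (adjoint_rip ss v u) (ripC ip v (s u)).
lra.
Qed.

(** With $u=rx$ the gap between the two sides is $\langle su,u\rangle+\|su\|^2$. *)
Lemma resolvent_le1 x : rip (r x) x <= sqn x.
Proof.
move: (rK x); set u := r x => xE; rewrite -{1 2}xE /sqn !ripE.
rewrite (ripC ip u (s u)).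
by have := s0 u; have := sqn_ge0 ipN (s u); rewrite /sqn; lra.
Qed.

Lemma resolvent_ge_sub x : sqn x - rip (s x) x <= rip (r x) x.
Proof. by have := resolvent_ge x x; rewrite -/(sqn x); lra. Qed.

(** Operator form of $1/(1+s)\le 1-s/2$ on $[0,1]$. With $u=rx$ the gap is half of $\langle
    su,u\rangle-\langle s(su),su\rangle$, and $\langle s(su),su\rangle\le\|su\|^2\le\langle
    su,u\rangle$. *)
Lemma resolvent_le_half x : (forall y, rip (s y) y <= sqn y) ->
  rip (r x) x <= sqn x - rip (s x) x / 2.
Proof.
move=> s1.
have s01 y : 0 <= rip (s y) y <= 1 * sqn y by rewrite s0 mul1r s1.
move: (rK x); set u := r x => xE.
have h1 := sqn_bound (vN_lin M_vN Ms) ss ltr01 s01 u.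
have h2 := s1 (s u).
rewrite -{1 2 3 4}xE /sqn (linD (vN_lin M_vN Ms)) !ripE (ripC ip u (s u)).
rewrite (adjoint_rip ss (s u) u).
by have := s0 u; move: h1 h2; rewrite /sqn; lra.
Qed.

End ResolventTheory.

Lemma resolvent_anti s s' r r' : Mpos s -> Mpos s' ->
  is_resolvent s r -> is_resolvent s' r' ->
  (forall x, rip (s x) x <= rip (s' x) x) ->
  forall x, rip (r' x) x <= rip (r x) x.
Proof.
move=> ps ps' rs rs' ss' x.
have := resolvent_ge ps rs x (r' x); have := ss' (r' x).
have : rip (r' x) x = sqn (r' x) + rip (s' (r' x)) (r' x).
  by rewrite -{2}(rs'.2 x) ripDr (ripC ip _ (s' _)).
by rewrite (ripC ip x); lra.
Qed.

End Resolvent.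

(** * Absolute continuity with respect to a trace *)

Section Trace.
Context {R : realType} {H : completeNormedModType R[i]}.
Context (ip : {dot H for Num.conj}) (ipN : norm_from_inner_product ip).
Context (M : set (H -> H)) (M_vN : von_neumann_algebra ip M).
Context (tau : (H -> H) -> \bar R) (tau_tr : tracial_weight ip M tau).

Local Notation rip := (rip ip).
Local Notation sqn := (sqn ip).
Local Notation selfadj A := (is_adjoint ip A A).
Local Notation Mpos := (pos_part ip M).

Lemma vN_pos0 : Mpos 0.
Proof.
apply/(vN_posP ipN M_vN); split=> [|x y|x]; first exact: (vN0 ipN M_vN).
  by rewrite linear0l linear0r.
by rewrite /rip linear0l.
Qed.

Lemma vN_posD A B : Mpos A -> Mpos B -> Mpos (A + B).
Proof.
move=> /(vN_posP ipN M_vN)[MA sA A0] /(vN_posP ipN M_vN)[MB sB B0].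
apply/(vN_posP ipN M_vN); split=> [||x]; first exact: (vND ipN M_vN).
  exact: selfadjD.
by rewrite fctE ripDl addr_ge0.
Qed.

Lemma vN_posB A B : Mpos A -> Mpos B ->
  (forall x, rip (A x) x <= rip (B x) x) -> Mpos (B - A).
Proof.
move=> /(vN_posP ipN M_vN)[MA sA A0] /(vN_posP ipN M_vN)[MB sB B0] AB.
apply/(vN_posP ipN M_vN); split=> [||x]; first exact: (vNB ipN M_vN).
  exact: selfadjB.
by rewrite fctE ripDl ripNl subr_ge0.
Qed.

Lemma vN_pos_id : Mpos id.
Proof.
apply/(vN_posP ipN M_vN); split=> // [|x]; first exact: (vN_id ipN M_vN).
exact: sqn_ge0.
Qed.

Lemma tau_ge0 A : Mpos A -> (0 <= tau A)%E.
Proof. by case: tau_tr => h _ _ _; apply: h. Qed.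

(** Homogeneity with scalar 0, where $0\cdot\infty=0$ excludes an infinite value. *)
Lemma tau0 : tau 0 = 0%E.
Proof.
have [_ _ /(_ 0 0 (lexx 0) vN_pos0) + _] := tau_tr.
by rewrite scaler0 mul0e.
Qed.

Lemma tauD A B : Mpos A -> Mpos B -> tau (A + B) = (tau A + tau B)%E.
Proof. by case: tau_tr => _ h _ _; apply: h. Qed.

Lemma tau_le A B : Mpos A -> Mpos B ->
  (forall x, rip (A x) x <= rip (B x) x) -> (tau A <= tau B)%E.
Proof.
move=> pA pB AB; have pBA := vN_posB pA pB AB.
by rewrite -[B](subrKC A) tauD // leeDl // tau_ge0.
Qed.

Lemma tau_sum (I : finType) (F : I -> H -> H) : (forall i, Mpos (F i)) ->
  tau (\sum_i F i) = (\sum_i tau (F i))%E.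
Proof.
move=> pF; suff [] : Mpos (\sum_i F i) /\ tau (\sum_i F i)
  = (\sum_i tau (F i))%E.
  by [].
elim/big_rec2: _ => [|i u v _ [pv <-]]; first by rewrite tau0; split=> //;
  apply: vN_pos0.
by split; [apply: vN_posD | rewrite tauD].
Qed.

Context (tau_faithful : faithful_weight ip M tau).
Context (tau_normal : normal_weight ip M tau).

(** The strong limit of an increasing sequence is its least upper bound in the positive part, so
    normality gives $\tau(L)=\sup_n\tau(A_n)$. *)
Lemma tau_monotone_le (A : nat -> H -> H) (c : R) :
  (forall n, Mpos (A n)) ->
  (forall n m x, (n <= m)%N -> rip (A n x) x <= rip (A m x) x) ->
  (forall n x, rip (A n x) x <= sqn x) -> (forall n, tau (A n) <= c%:E)%E ->
  exists2 L, Mpos L /\ (tau L <= c%:E)%E & forall x, (A ^~ x) @ \oo --> L x.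
Proof.
move=> pA Amono A1 Ac.
have [L pL AL] := monotone_operator_cvg ipN M_vN pA Amono A1.
exists L => //; split=> //.
have /(vN_posP ipN M_vN)[_ sL _] := pL.
have sA n : selfadj (A n) by have /(vN_posP ipN M_vN)[] := pA n.
rewrite (tau_normal (D := range A));
  first by apply: ge_ereal_sup => _ [_ [n _ <-] <-].
- by move=> _ [n _ <-].
- split; first by exists (A 0%N), 0%N.
  move=> _ _ [n _ <-] [m _ <-]; exists (A (maxn n m)); split;
    first by exists (maxn n m).
    by apply/le_opP => // x; apply: Amono; rewrite leq_maxl.
  by apply/le_opP => // x; apply: Amono; rewrite leq_maxr.
- split=> // [_ [n _ <-]|B /(vN_posP ipN M_vN)[_ sB _] AB];
  apply/le_opP => // x.
    by apply: (cvg_rip_ge ipN) (AL x) _; exists n => // m; apply: Amono.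
  apply: (cvg_rip_le ipN) (AL x) _; apply: nearW => n.
  by have /le_opP := AB (A n) (ex_intro2 _ _ n I erefl); apply.
Qed.

Lemma geometric_le0 (r C b : R) : 0 < b -> b < 1 ->
  (forall n, r <= C * b ^+ n) -> r <= 0.
Proof.
move=> b0 b1 rC.
have : (fun n => C * b ^+ n) @ \oo --> C * 0.
  by apply: cvgMr; apply: cvg_expr; rewrite gtr0_norm.
rewrite mulr0 => cv; rewrite -(cvg_lim _ cv) //.
by apply: limr_ge => //; [apply: cvgP cv | apply: nearW].
Qed.

(* The sums [s n m] of the [y k], [n <= k < n + m], may blow up as [m] grows;
   [s (1 + s)^-1] has the same order properties and stays below [1]. *)
Lemma trace_abs_continuous (y : nat -> H -> H) (K b delta : R) (psi : H) :
  0 < delta -> 0 < b -> b < 1 -> (forall n, Mpos (y n)) ->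
  (forall n x, rip (y n x) x <= sqn x) ->
  (forall n, tau (y n) <= (K * b ^+ n)%:E)%E ->
  ~ (forall n, delta <= rip (y n psi) psi).
Proof.
move=> d0 b0 b1 py y1 ty yd.
(* Peeling off the first summand makes the comparison of [s n.+1 m] with [s n m.+1] immediate. *)
pose s := fix s n m := if m is k.+1 then y n + s n.+1 k else (0 : H -> H).
have s0 n : s n 0%N = 0 by [].
have sS n m : s n m.+1 = y n + s n.+1 m by [].
clearbody s.
have ps n m : Mpos (s n m).
  by elim: m n => [|m IHm] n; rewrite ?s0 ?sS;
    [exact: vN_pos0 | apply: vN_posD].
(* $Cb^n$ is the sum of the geometric tail $Kb^k$, $k\ge n$. *)
pose C := K / (1 - b).
have C0 : 0 <= C.
  apply: divr_ge0; last by rewrite subr_ge0 ltW.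
  by have := le_trans (tau_ge0 (py 0%N)) (ty 0%N); rewrite lee_fin expr0 mulr1.
have CE : K + C * b = C by rewrite /C; field; rewrite subr_eq0 gt_eqF.
have ts n m : (tau (s n m) <= (C * b ^+ n)%:E)%E.
  elim: m n => [|m IHm] n; last first.
    rewrite sS tauD // -[C in leRHS]CE mulrDl -mulrA -exprS EFinD.
    exact: leeD.
  by rewrite s0 tau0 lee_fin mulr_ge0 // exprn_ge0 // ltW.
have y0 n x : 0 <= rip (y n x) x by have /(vN_posP ipN M_vN)[_ _] := py n.
have s_mono n m x : rip (s n m x) x <= rip (s n m.+1 x) x.
  elim: m n => [|m IHm] n.
    by have /(vN_posP ipN M_vN)[_ _] := ps n 1%N; rewrite s0 /rip linear0l;
      apply.
  by rewrite [s n m.+2]sS [s n m.+1]sS !fctE !ripDl lerD2l.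
have s1 n : s n 1%N = y n by rewrite sS s0 addr0.
pose r n m := sval (cid (resolvent_exists ipN M_vN (ps n m))).
have rs n m : is_resolvent M (s n m) (r n m) by rewrite /r; case: cid.
clearbody r.
(* This is $s(1+s)^{-1}=1-(1+s)^{-1}$: increasing in $s$, and below both $1$ and $s$. *)
pose z n m := id - r n m.
have pr n m : Mpos (r n m) := resolvent_pos ipN M_vN (ps n m) (rs n m).
have zE n m x : rip (z n m x) x = sqn x - rip (r n m x) x.
  by rewrite /z !fctE ripDl ripNl.
have pz n m : Mpos (z n m).
  by apply: vN_posB vN_pos_id _ => // x;
    apply: (resolvent_le1 ipN M_vN (ps n m)).
have z1 n m x : rip (z n m x) x <= sqn x.
  by rewrite zE gerBl; have /(vN_posP ipN M_vN)[_ _] := pr n m.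
have z_s n n' m m' x : (forall x, rip (s n m x) x <= rip (s n' m' x) x) ->
    rip (z n m x) x <= rip (z n' m' x) x.
  move=> h; rewrite !zE lerD2l lerN2.
  exact: (resolvent_anti ipN M_vN (ps n m) (ps n' m')).
have z_mono n m m' x : (m <= m')%N -> rip (z n m x) x <= rip (z n m' x) x.
  move=> /subnK <-; elim: (m' - m)%N => // k IHk.
  by rewrite (le_trans IHk) // addSn; apply: z_s => w.
have tz n m : (tau (z n m) <= (C * b ^+ n)%:E)%E.
  apply: le_trans (ts n m); apply: tau_le => // x.
  by have := resolvent_ge_sub ipN M_vN (ps n m) (rs n m) x; rewrite zE; lra.
have zd n : delta / 2 <= rip (z n 1%N psi) psi.
  have := resolvent_le_half ipN M_vN (ps n 1%N) (rs n 1%N) psi.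
  by rewrite zE s1 => /(_ (y1 n)); have := yd n; lra.
(* Noncommutative Borel-Cantelli: first the supremum [L n] over [m], then the infimum [Z] over [n],
   a stand-in for the limit superior of the [y n]. *)
have Lex n := cid2 (tau_monotone_le (pz n) (z_mono n) (z1 n) (tz n)).
pose L n := s2val (Lex n).
have pL n : Mpos (L n) by rewrite /L; case: (Lex n) => ? [].
have tL n : (tau (L n) <= (C * b ^+ n)%:E)%E by rewrite /L;
  case: (Lex n) => ? [].
have zL n x : (z n ^~ x) @ \oo --> L n x := s2valP' (Lex n) x.
clearbody L.
have z_le_L n m x : rip (z n m x) x <= rip (L n x) x.
  by apply: (cvg_rip_ge ipN) (zL n x) _; exists m => // k; apply: z_mono.
have L1 n x : rip (L n x) x <= sqn x.
  by apply: (cvg_rip_le ipN) (zL n x) _; apply: nearW => m; apply: z1.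
have L_anti n x : rip (L n.+1 x) x <= rip (L n x) x.
  apply: (cvg_rip_le ipN) (zL n.+1 x) _; apply: nearW => m.
  apply: le_trans (z_le_L n m.+1 x); apply: z_s => w.
  by rewrite sS fctE ripDl lerDr.
(* Complements turn the decreasing [L n] into an increasing sequence, to which the monotone limit
   applies. *)
pose W n := id - L n.
have WE n x : rip (W n x) x = sqn x - rip (L n x) x.
  by rewrite /W !fctE ripDl ripNl.
have pW n : Mpos (W n) by apply: vN_posB vN_pos_id _.
have W1 n x : rip (W n x) x <= sqn x.
  by rewrite WE gerBl; have /(vN_posP ipN M_vN)[_ _] := pL n.
have W_mono n m x : (n <= m)%N -> rip (W n x) x <= rip (W m x) x.
  move=> /subnK <-; elim: (m - n)%N => // k IHk.
  by rewrite (le_trans IHk) // addSn !WE lerD2l lerN2.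
have [V pV WV] := monotone_operator_cvg ipN M_vN pW W_mono W1.
pose Z := id - V.
have ZE x : rip (Z x) x = sqn x - rip (V x) x.
  by rewrite /Z !fctE ripDl ripNl.
have pZ : Mpos Z.
  apply: vN_posB vN_pos_id _ => // x.
  by apply: (cvg_rip_le ipN) (WV x) _; apply: nearW.
have ZL n x : rip (Z x) x <= rip (L n x) x.
  rewrite ZE lerBlDl -lerBlDr -WE.
  by apply: (cvg_rip_ge ipN) (WV x) _; exists n => // m; apply: W_mono.
have : delta / 2 <= rip (Z psi) psi.
  rewrite ZE lerBrDr -lerBrDl.
  apply: (cvg_rip_le ipN) (WV psi) _; apply: nearW => n.
  by rewrite WE lerD2l lerN2 (le_trans (zd n)).
have tZ n : (tau Z <= (C * b ^+ n)%:E)%E by apply: le_trans (tL n);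
  apply: tau_le.
(* $\tau(Z)\le Cb^n$ for all $n$ gives $\tau(Z)=0$; faithfulness then contradicts the lower bound at
   [psi]. *)
have -> : Z = 0.
  apply: tau_faithful => //; move: tZ (tau_ge0 pZ).
  case: (tau Z) => [t|/(_ 0%N)|] // tZ t0; congr _%:E; apply/eqP.
  rewrite eq_le; apply/andP; split; last by rewrite -lee_fin.
  by apply: (geometric_le0 b0 b1 (C := C)) => n; rewrite -lee_fin.
by rewrite /rip linear0l; lra.
Qed.

End Trace.

(** * Embezzlement *)

Section Embezzlement.
Context {R : realType} {H : completeNormedModType R[i]}.
Context (ip : {dot H for Num.conj}) (ipN : norm_from_inner_product ip).
Context (M : set (H -> H)) (M_vN : von_neumann_algebra ip M).
Context (psi : H) (psi_separating : separating_vector M psi).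

Local Notation rip := (rip ip).
Local Notation sqn := (sqn ip).
Local Notation selfadj A := (is_adjoint ip A A).
Local Notation Mpos := (pos_part ip M).
Local Notation "A ^+*" := (adj ip A) (at level 2, format "A ^+*").

Hypothesis psi1 : sqn psi = 1.

Lemma vN_pos_gram a : M a -> Mpos (a^+* \o a).
Proof.
move=> Ma; have aa := vN_adjoint ipN M_vN Ma.
apply/(vN_posP ipN M_vN); split=> [|x y|x] /=.
- by apply: (vN_comp ipN M_vN) => //; apply: (vN_adj ipN M_vN).
- by rewrite (adjoint_sym aa (a x)) (aa x).
- by rewrite (adjoint_rip (adjoint_sym aa)); apply: sqn_ge0.
Qed.

Lemma gramE a x : M a -> rip ((a^+* \o a) x) x = sqn (a x).
Proof.
by move=> Ma; rewrite /= (adjoint_rip (adjoint_sym (vN_adjoint ipN M_vN Ma))).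
Qed.

(** * The column isometry and the transported state *)

Context (d : nat) (V : 'I_d -> H -> H) (b : 'I_d -> R).
Hypothesis VM : forall i, M (V i).
Hypothesis b_sum : \sum_i b i = 1.
Hypothesis V_contraction : forall x, \sum_i sqn (V i x) <= sqn x.
Hypothesis V_embezzles : forall X, M X -> forall i j,
  rip (X (V j psi)) (V i psi) = (i == j)%:R * b i * rip (X psi) psi.

Lemma rip_sum I (r : seq I) (P : pred I) (F : I -> H) y :
  rip (\sum_(i <- r | P i) F i) y = \sum_(i <- r | P i) rip (F i) y.
Proof.
elim/big_rec2: _ => [|i u v _ <-]; first by rewrite /rip linear0l.
by rewrite ripDl.
Qed.

(** The defect $D=1-\sum_i V_i'V_i$ satisfies $0\le D\le 1$ and $\langle D\psi,\psi\rangle=1-\sum_i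
    b_i=0$. Hence $\|D\psi\|^2\le\langle D\psi,\psi\rangle=0$, and [psi] separates. *)
Lemma embezzling_isometry : \sum_i ((V i)^+* \o V i) = id.
Proof.
set S := \sum_i _.
have MS : M S by apply: (vN_sum ipN M_vN) => i; have [] := vN_pos_gram (VM i).
have SE x : rip (S x) x = \sum_i sqn (V i x).
  by rewrite /S fct_sumE rip_sum; apply: eq_bigr => i _; apply: gramE.
have pS : Mpos S.
  rewrite /S; elim/big_rec: _ => [|i u _ pu]; first exact: vN_pos0.
  by apply: vN_posD => //; apply: vN_pos_gram.
have pD : Mpos (id - S).
  by apply: vN_posB pS (vN_pos_id ipN M_vN) _ => // x; rewrite SE.
have /(vN_posP ipN M_vN)[MD sD D0] := pD.
have DE x : rip ((id - S) x) x = sqn x - rip (S x) x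
  by rewrite !fctE ripDl ripNl.
have D01 x : 0 <= rip ((id - S) x) x <= 1 * sqn x.
  rewrite D0 mul1r DE gerBl SE; apply: sumr_ge0 => i _; exact: sqn_ge0.
have := sqn_bound (vN_lin M_vN MD) sD ltr01 D01 psi.
have -> : rip ((id - S) psi) psi = 0.
  rewrite DE SE psi1 -b_sum -sumrB big1 // => i _.
  have : sqn (V i psi) = (i == i)%:R * b i * sqn psi.
    exact: (V_embezzles (vN_id ipN M_vN)).
  by rewrite eqxx mul1r psi1 mulr1 => ->; rewrite subrr.
rewrite mulr0 => Dpsi; have {}Dpsi : sqn ((id - S) psi) = 0.
  by apply/eqP; rewrite eq_le Dpsi sqn_ge0.
have /eqP := psi_separating MD (sqn_eq0 ipN Dpsi).
by rewrite subr_eq0 => /eqP <-.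
Qed.

(** Expand $a\psi=\sum_i aV_i'V_i\psi$ and apply the embezzling identity to $X=V_ia'aV_j'$: cross
    terms vanish and diagonal ones carry the weight $b_i$. *)
Lemma embezzling_state a : M a ->
  \sum_i b i * sqn (a ((V i)^+* psi)) = sqn (a psi).
Proof.
move=> Ma.
have V_adj i := vN_adjoint ipN M_vN (VM i).
have Mx i j : M (V i \o (a^+* \o a) \o (V j)^+*).
  apply: (vN_comp ipN M_vN); last exact: vN_adj.
  by apply: (vN_comp ipN M_vN) => //; have [] := vN_pos_gram Ma.
have xE i j u v : rip ((V i \o (a^+* \o a) \o (V j)^+*) u) v
    = rip (a ((V j)^+* u)) (a ((V i)^+* v)).
  by rewrite /= (adjoint_rip (V_adj i)) (adjoint_rip
    (adjoint_sym (vN_adjoint ipN M_vN Ma))).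
have psiE : a psi = \sum_i a ((V i)^+* (V i psi)).
  rewrite -(lin_sum (vN_lin M_vN Ma)); congr a.
  by rewrite -[LHS]/(id psi) -embezzling_isometry fct_sumE.
rewrite psiE /sqn rip_sum; apply: eq_bigr => i _.
rewrite ripC rip_sum (bigD1 i) //= big1 ?addr0 => [|j ji].
  by rewrite -!xE V_embezzles // eqxx mul1r.
by rewrite -xE V_embezzles // eq_sym (negPf ji) !mul0r.
Qed.

(** * Trace identity and the payoff function *)

Context (tau : (H -> H) -> \bar R) (tau_tr : tracial_weight ip M tau).

Lemma tau_gramC a : M a -> tau (a^+* \o a) = tau (a \o a^+*).
Proof. by case: tau_tr => _ _ _ h; apply: h. Qed.

(** Traciality turns $V_ia'aV_i'$ into $aV_i'V_ia'$; the isometry relation sums these to $aa'$, and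
    traciality returns to $a'a$. *)
Lemma embezzling_trace a : M a ->
  (\sum_i tau ((a \o (V i)^+*)^+* \o (a \o (V i)^+*)))%E = tau (a^+* \o a).
Proof.
move=> Ma; have MVi i := vN_adj ipN M_vN (VM i).
have Ma' := vN_adj ipN M_vN Ma.
have MaV i : M (a \o (V i)^+*) by apply: (vN_comp ipN M_vN).
have E i : (a \o (V i)^+*) \o (a \o (V i)^+*)^+*
  = (V i \o a^+*)^+* \o (V i \o a^+*).
  rewrite (adj_comp ipN M_vN Ma (MVi i)) (adj_comp ipN M_vN (VM i) Ma').
  by rewrite (vN_adjK ipN M_vN (VM i)) (vN_adjK ipN M_vN Ma).
rewrite (eq_bigr (fun i => tau ((V i \o a^+*)^+* \o (V i \o a^+*)))) => [|i _].
  rewrite -(tau_sum ipN M_vN tau_tr) => [|i].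
    rewrite (tau_gramC Ma); congr tau; apply/funext => x; rewrite fct_sumE /=.
    rewrite (eq_bigr (fun i => a ((V i)^+* (V i (a^+* x))))) => [|i _].
      rewrite -(lin_sum (vN_lin M_vN Ma)); congr a.
      by rewrite -[RHS]/(id (a^+* x)) -embezzling_isometry fct_sumE.
    rewrite (adj_comp ipN M_vN (VM i) Ma').
    by rewrite (vN_adjK ipN M_vN Ma).
  by apply: vN_pos_gram; apply: (vN_comp ipN M_vN).
by rewrite tau_gramC // E.
Qed.

(* If omega = tau(h .), the supremum of these values is tau((h - c)_+). *)
Definition payoffs (c : R) : set R :=
  [set r | exists a, [/\ M a, forall x, sqn (a x) <= sqn x,
     (tau (a^+* \o a) < +oo)%E & r = sqn (a psi) - c * fine (tau (a^+* \o a))]].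

Definition payoff (c : R) : R := sup (payoffs c).

Lemma fine_tau_ge0 a : M a -> 0 <= fine (tau (a^+* \o a)).
Proof. by move=> Ma; apply/fine_ge0/(tau_ge0 tau_tr)/vN_pos_gram. Qed.

Lemma tau_gram_fine a : M a -> (tau (a^+* \o a) < +oo)%E ->
  tau (a^+* \o a) = (fine (tau (a^+* \o a)))%:E.
Proof.
move=> Ma ta; rewrite fineK // ge0_fin_numE //.
by apply/(tau_ge0 tau_tr)/vN_pos_gram.
Qed.

Lemma payoffs_has_sup c : 0 <= c -> has_sup (payoffs c).
Proof.
move=> c0; split.
  have M0 := vN0 ipN M_vN.
  have E0 : (0 : H -> H)^+* \o (0 : H -> H) = 0.
    apply/funext => x; apply: (lin0 (vN_lin M_vN _)); exact: (vN_adj ipN M_vN).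
  exists (sqn ((0 : H -> H) psi) - c * fine (tau ((0 : H ->
    H)^+* \o (0 : H -> H)))).
  exists 0; split=> // [x|]; last by rewrite E0 (tau0 ipN M_vN tau_tr).
  by rewrite {1}/sqn /rip linear0l sqn_ge0.
exists 1 => _ [a [Ma a1 _ ->]].
have := a1 psi; rewrite psi1; have := mulr_ge0 c0 (fine_tau_ge0 Ma); lra.
Qed.

Lemma payoff_ge c a : 0 <= c -> M a -> (forall x, sqn (a x) <= sqn x) ->
  (tau (a^+* \o a) < +oo)%E ->
  sqn (a psi) - c * fine (tau (a^+* \o a)) <= payoff c.
Proof.
move=> c0 Ma a1 ta; apply: ub_le_sup; first by case: (payoffs_has_sup c0).
by exists a.
Qed.

Lemma payoff_le c (e : R) : 0 <= c ->
  (forall a, M a -> (forall x, sqn (a x) <= sqn x) ->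
    (tau (a^+* \o a) < +oo)%E ->
    sqn (a psi) - c * fine (tau (a^+* \o a)) <= e) -> payoff c <= e.
Proof.
move=> c0 h; apply: ge_sup; first by case: (payoffs_has_sup c0).
by move=> _ [a [Ma a1 ta ->]]; apply: h.
Qed.

Lemma payoff_anti c c' : 0 <= c -> c <= c' -> payoff c' <= payoff c.
Proof.
move=> c0 cc'; apply: payoff_le => [|a Ma a1 ta]; first exact: le_trans cc'.
apply: le_trans (payoff_ge c0 Ma a1 ta).
by rewrite lerD2l lerN2 ler_wpM2r // fine_tau_ge0.
Qed.

Hypothesis b_gt0 : forall i, 0 < b i.

(** Young's inequality gives $2\|a'x\|^2=2\langle
    x,aa'x\rangle\le\|x\|^2+\|aa'x\|^2\le\|x\|^2+\|a'x\|^2$. *)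
Lemma adj_contraction a : M a -> (forall x, sqn (a x) <= sqn x) ->
  forall x, sqn (a^+* x) <= sqn x.
Proof.
move=> Ma a1 x.
have aa := adjoint_sym (vN_adjoint ipN M_vN Ma).
have := rip_le ipN x (a (a^+* x)) ltr01.
rewrite invr1 !mul1r -(adjoint_rip aa) -/(sqn _).
by have := a1 (a^+* x); lra.
Qed.

Lemma V_le1 i x : sqn (V i x) <= sqn x.
Proof.
apply: le_trans (V_contraction x); rewrite (bigD1 i) //= lerDl.
by apply: sumr_ge0 => j _; apply: sqn_ge0.
Qed.

(** Each [payoff (c / b i)] is tested with $f_i=aV_i'$; the factor $b_i$ cancels in the trace term,
    and the state and trace identities reassemble the payoff of $a$ at $c$. *)
Lemma payoff_average c : 0 <= c -> payoff c <= \sum_i b i * payoff (c / b i).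
Proof.
move=> c0; apply: payoff_le => // a Ma a1 ta.
pose f i := a \o (V i)^+*.
have Mf i : M (f i) by apply: (vN_comp ipN M_vN) => //;
  apply: (vN_adj ipN M_vN).
have f1 i x : sqn (f i x) <= sqn x.
  by rewrite (le_trans (a1 _)) //; apply: adj_contraction => // y; apply: V_le1.
have tfE := embezzling_trace Ma.
have tf i : (tau ((f i)^+* \o f i) < +oo)%E.
  apply: le_lt_trans ta; rewrite -tfE (bigD1 i) //= leeDl //.
  by apply: sume_ge0 => j _; exact: (tau_ge0 tau_tr (vN_pos_gram (Mf j))).
have -> : fine (tau (a^+* \o a)) = \sum_i fine (tau ((f i)^+* \o f i)).
  rewrite -tfE -sum_fine // => i _; rewrite ge0_fin_numE; first exact: tf.
  exact: (tau_ge0 tau_tr (vN_pos_gram (Mf i))).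
rewrite -(embezzling_state Ma) mulr_sumr -sumrB; apply: ler_sum => i _.
have h := payoff_ge (divr_ge0 c0 (ltW (b_gt0 i))) (Mf i) (f1 i) (tf i).
apply: le_trans (ler_wpM2l (ltW (b_gt0 i)) h).
by rewrite mulrBr mulrA [b i * (c / b i)]mulrC divfK // gt_eqF.
Qed.

Context (i0 : 'I_d) (b_lt1 : b i0 < 1).

(** In the average, monotonicity bounds every term with $i\ne i_0$ by $b_i$ times [payoff c]; what
    remains is the claim multiplied by $b_{i_0}$. *)
Lemma payoff_div c : 0 <= c -> payoff c <= payoff (c / b i0).
Proof.
move=> c0; have := payoff_average c0.
have b_le1 i : b i <= 1.
  rewrite -b_sum (bigD1 i) //= lerDl; apply: sumr_ge0 => j _; exact: ltW.
rewrite (bigD1 i0) //= => avg.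
have h : \sum_(i | i != i0) b i * payoff (c / b i) <= (1 - b i0) * payoff c.
  have -> : 1 - b i0 = \sum_(i | i != i0) b i.
    by rewrite -b_sum (bigD1 i0) //= addrAC subrr add0r.
  rewrite mulr_suml.
  apply: ler_sum => i _; rewrite ler_pM2l //; apply: payoff_anti => //.
  by rewrite ler_pdivlMr // ler_piMr.
rewrite mulrBl mul1r in h.
by rewrite -(ler_pM2l (b_gt0 i0)); lra.
Qed.

(** * The contradiction with semifiniteness *)

Context (tau_faithful : faithful_weight ip M tau).
Context (tau_normal : normal_weight ip M tau).
Context (tau_semifinite : semifinite_trace ip M tau).

(** Semifiniteness supplies a nonzero positive $B$ of finite trace. For $B\le C$ the contraction
    $a=B/C$ has $a'a\le B/C$, hence finite trace, and $a\psi\ne0$ since [psi] separates. *)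
Lemma payoff_pos : exists2 c, 0 < c & 0 < payoff c.
Proof.
have idN0 : (id : H -> H) <> 0.
  move=> /(congr1 (fun f => sqn (f psi))); rewrite psi1 /sqn /rip linear0l.
  by move=> /eqP; rewrite oner_eq0.
have [B [pB B0 _ tB]] := tau_semifinite (vN_pos_id ipN M_vN) idN0.
have /(vN_posP ipN M_vN)[MB sB B_ge0] := pB.
have [e e0 Be] := vN_bound ipN M_vN MB.
pose C := (e + 1) / 2; have C0 : 0 < C by rewrite /C; lra.
have BC x : 0 <= rip (B x) x <= C * sqn x.
  rewrite B_ge0; have := rip_le ipN (B x) x ltr01; have := Be x.
  by rewrite invr1 !mul1r /C; lra.
pose a := C^-1%:C *: B.
have Ma : M a by apply: (vNZ ipN M_vN).
have aE x : sqn (a x) = C^-1 * (C^-1 * sqn (B x)) by rewrite /a fctE /sqn !ripE.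
have Cge0 : 0 <= C^-1 by rewrite invr_ge0 ltW.
have a_le x : sqn (a x) <= C^-1 * rip (B x) x.
  rewrite aE ler_wpM2l // ler_pdivrMl //.
  exact: (sqn_bound (vN_lin M_vN MB) sB C0 BC).
have a1 x : sqn (a x) <= sqn x.
  by rewrite (le_trans (a_le x)) // ler_pdivrMl //; have /andP[] := BC x.
have pCB : Mpos (C^-1%:C *: B).
  apply/(vN_posP ipN M_vN); split=> // [|x].
    by apply: rip_selfadj (vN_lin M_vN Ma) _ => x y;
      rewrite /a !fctE !ripE (adjoint_rip sB).
  by rewrite fctE ripZl mulr_ge0.
have ta : (tau (a^+* \o a) < +oo)%E.
  apply: (@le_lt_trans _ _ (tau (C^-1%:C *: B))).
    apply: (tau_le ipN M_vN tau_tr) => // [|x]; first exact: vN_pos_gram.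
    by rewrite gramE // fctE ripZl a_le.
  have [_ _ tauZ _] := tau_tr; rewrite tauZ // lte_mul_pinfty //.
have apsi : 0 < sqn (a psi).
  rewrite lt_neqAle sqn_ge0 // andbT eq_sym aE; apply/negP.
  rewrite !mulf_eq0 invr_eq0 (gt_eqF C0) /= => /eqP /(sqn_eq0 ipN).
  by move=> /(psi_separating MB).
set t := fine (tau (a^+* \o a)); have t0 : 0 <= t by apply: fine_tau_ge0.
have t1 : 0 < t + 1 by lra.
(* This $c$ solves $\|a\psi\|^2-ct=c$, so the payoff of $a$ at $c$ is $c$ itself. *)
have c0 : 0 < sqn (a psi) / (t + 1) by rewrite divr_gt0.
exists (sqn (a psi) / (t + 1)) => //.
apply: lt_le_trans (payoff_ge (ltW c0) Ma a1 ta); rewrite -/t.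
have -> : sqn (a psi) - sqn (a psi) / (t + 1) * t = sqn (a psi) / (t + 1).
  by field; rewrite gt_eqF.
by [].
Qed.

Lemma embezzlement_not_semifinite : False.
Proof.
have [c c0 Sc] := payoff_pos.
set delta := payoff c in Sc.
pose cn n := c / b i0 ^+ n.
have bn n : 0 < b i0 ^+ n by rewrite exprn_gt0.
have cn0 n : 0 < cn n by rewrite divr_gt0.
have Scn n : delta <= payoff (cn n).
  elim: n => [|n IHn]; first by rewrite /cn expr0 divr1.
  rewrite (le_trans IHn) // (le_trans (payoff_div (ltW (cn0 n)))) //.
  by rewrite /cn -mulrA -invfM exprSr.
have ex n : exists a, [/\ M a, forall x, sqn (a x) <= sqn x,
    delta / 2 <= sqn (a psi) & (tau (a^+* \o a) <= (c^-1 * b i0 ^+ n)%:E)%E].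
  have d2 : 0 < delta / 2 by rewrite divr_gt0.
  (* A near-maximizer at $c_n$ has payoff above $\delta/2>0$. This forces $\|a\psi\|^2\ge\delta/2$
     and $c_n\tau(a'a)\le\|a\psi\|^2\le1$. *)
  have [_ [a [Ma a1 ta ->]]] := sup_adherent d2 (payoffs_has_sup (ltW (cn0 n))).
  rewrite -/(payoff _) => h; have := Scn n => h'.
  have h0 := mulr_ge0 (ltW (cn0 n)) (fine_tau_ge0 Ma).
  exists a; split=> //; first by lra.
  rewrite (tau_gram_fine Ma ta) lee_fin.
  have -> : c^-1 * b i0 ^+ n = (cn n)^-1 by rewrite /cn invf_div mulrC.
  rewrite -[leRHS]mulr1 -ler_pdivrMl ?invr_gt0 // invrK.
  by have := a1 psi; rewrite psi1; lra.
pose a n := sval (cid (ex n)).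
have Ma n : M (a n) by rewrite /a; case: cid => ? [].
have a1 n x : sqn (a n x) <= sqn x by rewrite /a; case: cid => ? [].
have ad n : delta / 2 <= sqn (a n psi) by rewrite /a; case: cid => ? [].
have ta n : (tau ((a n)^+* \o a n) <= (c^-1 * b i0 ^+ n)%:E)%E.
  by rewrite /a; case: cid => ? [].
have d2 : 0 < delta / 2 by rewrite divr_gt0.
apply: (trace_abs_continuous ipN M_vN tau_tr tau_faithful tau_normal
   (y := fun n => (a n)^+* \o a n) d2 (b_gt0 i0) b_lt1 _ _ ta) => n.
- exact: vN_pos_gram.
- by move=> x; rewrite gramE.
- by rewrite gramE.
Qed.

End Embezzlement.

(** * Reduction to the first column of the embezzling contraction *)

Theorem theorem4p4 (R : realType) (H : completeNormedModType R[i])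
    (ip : {dot H for Num.conj}) (Hip : norm_from_inner_product ip)
    (d : nat) (d_ge2 : (2 <= d)%N) (alpha : 'I_d -> R)
    (alpha_decr : forall i j : 'I_d, (i <= j)%N -> alpha j <= alpha i)
    (alpha_gt0 : forall i : 'I_d, 0 < alpha i)
    (alpha_sum : \sum_(i < d) alpha i ^+ 2 = 1)
    (M : set (H -> H)) (M_vN : von_neumann_algebra ip M)
    (T : 'I_d -> 'I_d -> (H -> H)) (psi : H)
    (psi_cyclic : cyclic_vector M psi)
    (psi_separating : separating_vector M psi)
    (T_embezzles : exactly_embezzles ip M (ltnW d_ge2) alpha T psi) :
  ~ semifinite ip M.
Proof.
move=> [tau [tau_tr tau_faithful tau_normal tau_semifinite]].
case: T_embezzles; set o := Ordinal _ => MT T1 psi1 embez.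
have alpha2_gt0 i : 0 < alpha i ^+ 2 by rewrite exprn_gt0.
(* Since $d\ge2$, the index 1 contributes a second positive square to the sum. *)
have alpha2_lt1 : alpha o ^+ 2 < 1.
  rewrite -alpha_sum (bigD1 o) //= ltrDl (bigD1 (Ordinal d_ge2)) //=.
  by rewrite ltr_pwDl // sumr_ge0 // => i _; apply: ltW.
clearbody o.
have normE x : `|x| ^+ 2 = (sqn ip x)%:C by rewrite Hip ipxx.
have sqn_psi : sqn ip psi = 1.
  by apply: complexI; rewrite -normE psi1 expr1n.
(* Test the block contraction on the vector with [x] in coordinate [o] and 0 elsewhere. *)
have T_contraction x : \sum_i sqn ip (T i o x) <= sqn ip x.
  have := T1 (fun j => if j == o then x else 0).
  rewrite -lecR rmorph_sum /=; congr (_ <= _).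
    apply: eq_bigr => i _; rewrite -normE (bigD1 o) //= eqxx big1 ?addr0 //.
    by move=> j /negPf ->; apply: (lin0 (vN_lin M_vN (MT i j))).
  rewrite (bigD1 o) //= eqxx normE big1 ?addr0 // => j /negPf ->.
  by rewrite normr0 expr0n.
have T_embezzles X : M X -> forall i j,
    rip ip (X (T j o psi)) (T i o psi)
      = (i == j)%:R * alpha i ^+ 2 * rip ip (X psi) psi.
  move=> MX i j; have := embez X MX i j; rewrite /vector_state /=.
  rewrite (adjoint_sym (vN_adjoint Hip M_vN (MT i o))) /rip => ->.
  case: (i == j); rewrite ?mul0r // !mul1r.
  by rewrite mulrC Re_mul_real mulrC.
exact: (embezzlement_not_semifinite Hip M_vN psi_separating sqn_psi
  (fun i => MT i o) alpha_sum T_contraction T_embezzles tau_tr alpha2_gt0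
  alpha2_lt1 tau_faithful tau_normal tau_semifinite).
Qed.
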